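(* $f(6,S_3)\le 15$.
   Context: $[n]=\{1,\dots,n\}$ and $\mathcal{P}(n)$ is the set of all subsets of $[n]$. $S_3$ (the claw) is the star with 3 edges. For a graph $G$, a hypergraph $H$ is called Berge-$G$ if there is a copy of $G$ with $V(G)\subseteq V(H)$ and a bijection $g:E(G)\to E(H)$ such that $e\subseteq g(e)$ for every $e\in E(G)$. A family of subsets of $[n]$ (viewed as a hypergraph with vertex set $[n]$) is $G$-free if it contains no subfamily that is a Berge-$G$ hypergraph. $f(n,G)$ denotes the smallest number of colors in a coloring (partition) of $\mathcal{P}(n)$ such that every color class is $G$-free. *)

(* Defs.v *)
From mathcomp Require Import all_boot.

Set Implicit Arguments.
Unset Strict Implicit.
Unset Printing Implicit Defensive.

Record sgraph := SGraph {
  vertex : finType;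
  adj : rel vertex;
  adj_sym : symmetric adj;
  adj_irr : irreflexive adj
}.

Definition edges (G : sgraph) : {set {set vertex G}} :=
  [set [set x; y] | x in vertex G, y in vertex G & adj x y].

Definition star_adj (k : nat) : rel 'I_k.+1 :=
  fun x y => (x == ord0) (+) (y == ord0).

Lemma star_adj_sym k : symmetric (@star_adj k).
Proof. by move=> x y; rewrite /star_adj addbC. Qed.

Lemma star_adj_irr k : irreflexive (@star_adj k).
Proof. by move=> x; rewrite /star_adj addbb. Qed.

(* The star with [k] edges: vertex [ord0] is joined to the [k] other ones. *)
Definition star (k : nat) : sgraph :=
  SGraph (@star_adj_sym k) (@star_adj_irr k).

Lemma card_edges_star k : #|edges (star k)| = k.
Proof.
have -> : edges (star k) = [set [set ord0; lift ord0 i] | i : 'I_k].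
  apply/setP=> e; apply/imset2P/imsetP=> [[x y _]|[i _ ->]]; last first.
    by apply: (Imset2spec (x1 := ord0 : vertex (star k))
                          (x2 := lift ord0 i : vertex (star k))); rewrite ?inE.
  rewrite !inE /= /star_adj.
  case: (unliftP ord0 x) => [i|] ->; case: (unliftP ord0 y) => [j|] -> //= _ ->.
    by exists i; rewrite // setUC.
  by exists j.
rewrite card_imset ?card_ord // => i j /setP/(_ (lift ord0 i)).
by rewrite !inE /= eqxx => /esym/eqP/lift_inj.
Qed.

(* The set {1, ..., n} is represented by ['I_n], and a hypergraph on it by its
   set of hyperedges.  The copy of [G] is the image of the injection [phi]; [g]
   only matters on [edges G], where it is a bijection onto [H]. *)
Definition berge (G : sgraph) (n : nat) (H : {set {set 'I_n}}) : bool :=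
  [exists phi : {ffun vertex G -> 'I_n},
   exists g : {ffun {set vertex G} -> {set 'I_n}},
    [&& injectiveb phi, dinjectiveb g (mem (edges G)), g @: edges G == H
      & [forall e in edges G, phi @: e \subset g e]]].

Definition berge_free (G : sgraph) (n : nat) (F : {set {set 'I_n}}) : bool :=
  ~~ [exists H : {set {set 'I_n}}, (H \subset F) && berge G H].

(* All subsets are coloured, the empty one included. *)
Definition free_colorable (G : sgraph) (n k : nat) : bool :=
  [exists c : {ffun {set 'I_n} -> 'I_k},
    [forall i : 'I_k, berge_free G [set A | c A == i]]].

(* Only [k <= 2 ^ n] need be considered: if some colouring has all its classes
   G-free, then so does the one giving each subset its own colour.  When no such
   colouring exists, which by [edges_gt1_colorable] requires [G] to have at
   most one edge, the value is the meaningless [2 ^ n]. *)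
Definition min_colors (n : nat) (G : sgraph) : nat :=
  [arg min_(k < (ord_max : 'I_(2 ^ n).+1) | free_colorable G n k) (k : nat)].

Lemma edges_gt1_colorable G n :
  1 < #|edges G| -> free_colorable G n (2 ^ n).
Proof.
move=> E2.
have cS : #|{set 'I_n}| = 2 ^ n by rewrite -cardsT -powersetT card_powerset cardsT card_ord.
apply/existsP; exists [ffun A => cast_ord cS (enum_rank A)].
apply/forallP=> i; apply/existsP=> -[H /andP[HF]].
case/existsP=> phi /existsP[g /and4P[_ /dinjectiveP gI /eqP gH _]].
move: E2; rewrite -(card_in_imset gI) gH ltnNge; apply/negP/negPn.
apply: (leq_trans (subset_leq_card HF)); apply/card_le1_eqP=> A B.
rewrite !inE !ffunE => /eqP <- /eqP/cast_ord_inj/enum_rank_inj->//.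
Qed.

Lemma min_colorsP G n : 1 < #|edges G| ->
  free_colorable G n (min_colors n G) /\
  (forall k, free_colorable G n k -> min_colors n G <= k).
Proof.
move=> /(edges_gt1_colorable n) C; rewrite /min_colors.
case: arg_minnP => // k Ck kmin; split=> // m Cm.
have [mle|mgt] := leqP m (2 ^ n); last by apply: leq_trans (ltnW mgt); rewrite -ltnS.
by have := kmin (Ordinal (mle : m < (2 ^ n).+1)); apply.
Qed.

(* Main.v *)
Require Import Defs.
From mathcomp Require Import all_boot.

(** A set with at most one element contains no edge, so only the 57 subsets
    with at least two elements matter.  A Berge star with [k] edges centred at
    [v] consists of [k] such sets through [v] with [k] distinct representatives
    other than [v].  It cannot occur at [v] if fewer than [k] sets of the family
    pass through [v], or if their union has fewer than [k] points besides [v]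
    ([berge_free_star]).  For [k = 3], a family is therefore harmless as soon as
    each vertex has degree at most 2, or else has as its only sets some of [vx],
    [vy], [vxy].

    Such families are nearly forced: each vertex lies in 31 sets of size at
    least 2, whereas 15 classes of degree 2 account for only 30.  The colouring
    makes up the deficit with one class in which each vertex has degree 3,
    namely the edges of the two triangles 012 and 345 together with 012 and 345
    themselves.  The other 49 sets split into 14 classes that are regular of
    degree 2:
    - each of the edges [ab] = 03, 14, 25, a perfect matching between the
      triangles, goes with the complements of [a] and of [b];
    - the two triangles and this matching form a prism, whose nine edges split
      into three perfect matchings; the complements of the edges of a perfect
      matching cover each vertex twice;
    - what is left is the full set and 15 complementary pairs, since a pair that
      is not an edge of the prism is left together with its complement, as are
      the triples other than 012 and 345.  The full set takes one complementary
      pair, and the others are put together two by two.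
    This is [classes]; that it has the two required properties is the finite
    computation of [classes_cover] and [classes_sparse]. *)

Set Implicit Arguments.
Unset Strict Implicit.
Unset Printing Implicit Defensive.

Definition star_at n (F : {set {set 'I_n}}) (v : 'I_n) : {set {set 'I_n}} :=
  [set A in F | (v \in A) && (1 < #|A|)].

(** The [k] edges of the star give [k] distinct sets through the centre, and its
    leaves are [k] distinct other points of their union. *)
Lemma berge_free_star k n (F : {set {set 'I_n}}) :
  (forall v, (#|star_at F v| < k) || (#|cover (star_at F v) :\ v| < k)) ->
  berge_free (star k) F.
Proof.
move=> sparse; apply/existsP=> -[H /andP[/subsetP HF]].
case/existsP=> phi /existsP[g].
case/and4P=> /injectiveP phi_inj /dinjectiveP g_inj /eqP gH /forall_inP phi_g.
pose v := phi ord0; pose leaf (i : 'I_k) := phi (lift ord0 i).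
pose e (i : 'I_k) : {set vertex (star k)} := [set ord0; lift ord0 i].
have e_edge i : e i \in edges (star k).
  by apply: imset2_f; rewrite ?inE.
have e_inj : injective e.
  move=> i j /setP/(_ (lift ord0 i)).
  by rewrite !inE eqxx /= => /esym/eqP/lift_inj.
have v_g i : v \in g (e i).
  by apply: (subsetP (phi_g _ (e_edge i))); apply: imset_f; rewrite !inE eqxx.
have leaf_g i : leaf i \in g (e i).
  by apply: (subsetP (phi_g _ (e_edge i))); apply: imset_f; rewrite !inE eqxx orbT.
have leaf_neq i : leaf i != v by rewrite (inj_eq phi_inj) eq_sym neq_lift.
have g_star i : g (e i) \in star_at F v.
  rewrite inE v_g HF -?gH ?imset_f //=; apply/card_gt1P.
  by exists (leaf i), v; split; rewrite ?leaf_g ?leaf_neq.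
have /orP[] := sparse v; rewrite ltnNge => /negP; apply.
  rewrite -[k in k <= _]card_ord -(card_imset _ (f := fun i => g (e i))).
    by apply/subset_leq_card/subsetP=> _ /imsetP[i _ ->].
  by move=> i j /(g_inj _ _ (e_edge i) (e_edge j))/e_inj.
rewrite -[k in k <= _]card_ord -(card_imset _ (f := leaf)).
  apply/subset_leq_card/subsetP=> _ /imsetP[i _ ->].
  by rewrite in_setD1 leaf_neq; apply/bigcupP; exists (g (e i)).
by move=> i j /phi_inj/lift_inj.
Qed.

(** Elements of [{set 'I_n}] do not compute; their increasing lists of values
    do, so that the colouring can be given and verified as a table. *)
Definition code n (A : {set 'I_n}) : seq nat := [seq val i | i <- enum A].

Lemma mem_code n (A : {set 'I_n}) i : (val i \in code A) = (i \in A).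
Proof. by rewrite mem_map ?mem_enum //; apply: val_inj. Qed.

Lemma code_inj n : injective (@code n).
Proof. by move=> A B AB; apply/setP=> i; rewrite -!mem_code AB. Qed.

Lemma size_code n (A : {set 'I_n}) : size (code A) = #|A|.
Proof. by rewrite size_map -cardE. Qed.

Lemma codeE n (A : {set 'I_n.+1}) :
  code A = [seq j <- iota 0 n.+1 | inord j \in A].
Proof.
rewrite -val_enum_ord filter_map /code -filter_predI; congr map.
by apply: eq_filter => i /=; rewrite inord_val andbT.
Qed.

Lemma leq_card_inj (T : finType) (U : eqType) (f : T -> U) (A : {set T})
    (s : seq U) :
  injective f -> {in A, forall x, f x \in s} -> #|A| <= size s.
Proof.
move=> f_inj As; rewrite cardE -(size_map f); apply: uniq_leq_size.
  by rewrite map_inj_uniq ?enum_uniq.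
by move=> _ /mapP[x + ->]; rewrite mem_enum => /As.
Qed.

Definition compl (s : seq nat) : seq nat := [seq i <- iota 0 6 | i \notin s].

(** Each of [0; 1; 2] is matched with itself plus 3.  The table follows the
    order of the construction above. *)
Definition classes : seq (seq (seq nat)) :=
  [:: [:: [:: 0; 1]; [:: 0; 2]; [:: 1; 2]; [:: 0; 1; 2];
          [:: 3; 4]; [:: 3; 5]; [:: 4; 5]; [:: 3; 4; 5]]]
  ++ [seq [:: [:: a; a + 3]; compl [:: a]; compl [:: a + 3]] | a <- iota 0 3]
  ++ [seq map compl M | M <- [:: [:: [:: 0; 1]; [:: 3; 4]; [:: 2; 5]];
                                 [:: [:: 0; 2]; [:: 3; 5]; [:: 1; 4]];
                                 [:: [:: 1; 2]; [:: 4; 5]; [:: 0; 3]]]]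
  ++ [:: [:: iota 0 6; [:: 0; 4]; compl [:: 0; 4]]]
  ++ [seq [:: p.1; compl p.1; p.2; compl p.2]
       | p <- [:: ([:: 0; 5], [:: 1; 3]);
                  ([:: 1; 5], [:: 2; 3]);
                  ([:: 2; 4], [:: 0; 1; 3]);
                  ([:: 0; 1; 4], [:: 0; 1; 5]);
                  ([:: 0; 2; 3], [:: 0; 2; 4]);
                  ([:: 0; 2; 5], [:: 0; 3; 4]);
                  ([:: 0; 3; 5], [:: 0; 4; 5])]].

Lemma classes_cover (A : {set 'I_6}) :
  1 < #|A| -> has (fun C => code A \in C) classes.
Proof. by rewrite -size_code codeE /=; do 6!case: (inord _ \in A). Qed.

(** The criterion of [berge_free_star], for [k = 3], read on codes. *)
Definition sparse_at (C : seq (seq nat)) (v : nat) : bool :=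
  let L := [seq s <- C | v \in s] in
  (size L < 3) || (size (undup [seq x <- flatten L | x != v]) < 3).

Lemma classes_sparse : all (fun C => all (sparse_at C) (iota 0 6)) classes.
Proof. by []. Qed.

Lemma berge_free_code (F : {set {set 'I_6}}) (C : seq (seq nat)) :
  all (sparse_at C) (iota 0 6) ->
  (forall A, A \in F -> 1 < #|A| -> code A \in C) -> berge_free (star 3) F.
Proof.
move=> /allP sparseC FC; apply: berge_free_star => v.
have star_code A : A \in star_at F v -> code A \in [seq s <- C | val v \in s].
  by rewrite inE mem_filter mem_code => /and3P[AF -> /(FC A AF)].
have /sparseC/orP[ltC|ltC] : val v \in iota 0 6 by rewrite mem_iota ltn_ord.
  by rewrite (leq_ltn_trans (leq_card_inj (@code_inj 6) star_code) ltC).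
apply/orP; right; apply: leq_ltn_trans ltC; apply: (leq_card_inj val_inj) => i.
rewrite in_setD1 mem_undup mem_filter => /andP[-> /bigcupP[A /star_code AC Ai]].
by apply/flattenP; exists (code A); rewrite ?mem_code.
Qed.

Lemma free_colorable_star3 : free_colorable (star 3) 6 15.
Proof.
pose c (A : {set 'I_6}) : 'I_15 := inord (find (fun C => code A \in C) classes).
(* Sets absent from the table have at most one element; [inord] then returns
   colour 0, and any colour would do. *)
apply/existsP; exists [ffun A => c A]; apply/forallP=> i.
apply: (@berge_free_code _ (nth [::] classes i)).
  by apply: (allP classes_sparse); apply: mem_nth; apply: ltn_ord.
move=> A; rewrite inE ffunE => /eqP <- /classes_cover Acov.
by rewrite inordK ?(nth_find [::] Acov) // -[15]/(size classes) -has_find.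
Qed.

Theorem proposition3 : min_colors 6 (star 3) <= 15.
Proof.
have star_gt1 : 1 < #|edges (star 3)| by rewrite card_edges_star.
exact: (min_colorsP 6 star_gt1).2 free_colorable_star3.
Qed.
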